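(* Let $\frac{1}{2} < \alpha < 1$ be a constant, let $p_n = n^{-\alpha}$, and let $G \sim G(n,p_n)$. Then with high probability $G$ cannot be reconstructed from its $1$-neighborhoods. That is, the probability that there exists a graph $H$ on the vertex set $[n]$ with $G \sim_1 H$ and $H$ not isomorphic to $G$ tends to $1$ as $n \to \infty$.
   Context: All graphs are simple and undirected, with labeled vertex set $V = [n] = \{1,\dots,n\}$. $G(n,p_n)$ is the Erdős–Rényi random graph on $[n]$: each pair of distinct vertices is an edge independently with probability $p_n$. ''With high probability'' means with probability tending to $1$ as $n \to \infty$. For a vertex $v$ of a graph $G$, $\mathcal{N}_r(v)$ is the subgraph of $G$ induced by all vertices at graph distance at most $r$ from $v$. For each $v \in V$ one observes $\mathcal{N}_r(v)$ with the central vertex $v$ labeled and all other vertices unlabeled. For two graphs $H_1, H_2$ on $V$, write $H_1 \sim_r H_2$ (they have the same $r$-neighborhoods) if for every $v \in V$ the $r$-neighborhood of $v$ in $H_1$ is isomorphic to the $r$-neighborhood of $v$ in $H_2$ (by an isomorphism fixing the labeled center $v$). $G$ is reconstructable from its $r$-neighborhoods if every graph $H$ on $V$ with $G \sim_r H$ is isomorphic to $G$. *)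

(* Defs.v *)
From HB Require Import structures.
From mathcomp Require Import all_boot all_order all_algebra.
From mathcomp Require Import all_classical all_reals all_analysis.
Import Order.TTheory GRing.Theory Num.Theory numFieldNormedType.Exports.

Set Implicit Arguments.
Unset Strict Implicit.
Unset Printing Implicit Defensive.

Local Open Scope ring_scope.

(* Edges are two-element sets, so symmetry and irreflexivity are built in. *)
Record sgraph (T : finType) := SGraph {
  edges :> {set {set T}};
  edges_card2 : [forall e in edges, #|e| == 2%N] }.

HB.instance Definition _ (T : finType) := [isSub for @edges T].
HB.instance Definition _ (T : finType) := [Countable of sgraph T by <:].
HB.instance Definition _ (T : finType) := [Finite of sgraph T by <:].

Definition adj (T : finType) (G : sgraph T) : rel T :=
  fun x y => [set x; y] \in edges G.

Lemma induced_card2 (T : finType) (G : sgraph T) (A : {set T}) :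
  [forall e in [set e : {set {x : T | x \in A}} | [set val x | x in e] \in edges G],
     #|e| == 2%N].
Proof.
apply/forall_inP => e; rewrite inE => he.
by rewrite -(card_imset _ val_inj); exact: (forall_inP (edges_card2 G)).
Qed.

Definition induced_subgraph (T : finType) (G : sgraph T) (A : {set T}) :
    sgraph {x : T | x \in A} :=
  SGraph (induced_card2 G A).

(* The vertices at distance at most r from v: the endpoints of the walks from v
   with k <= r edges (the tuple p lists the vertices of the walk after v). *)
Definition dist_ball (T : finType) (G : sgraph T) (r : nat) (v : T) : {set T} :=
  [set u | [exists k : 'I_r.+1, exists p : k.-tuple T,
              path (adj G) v p && (last v p == u)]].

Lemma dist_ball_center (T : finType) (G : sgraph T) (r : nat) (v : T) :
  v \in dist_ball G r v.
Proof.
rewrite inE; apply/existsP; exists ord0; apply/existsP; exists [tuple].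
by rewrite /= eqxx.
Qed.

Definition neighborhood (T : finType) (G : sgraph T) (r : nat) (v : T) :
    sgraph {x : T | x \in dist_ball G r v} :=
  induced_subgraph G (dist_ball G r v).

Definition nbhd_center (T : finType) (G : sgraph T) (r : nat) (v : T) :
    {x : T | x \in dist_ball G r v} :=
  exist _ v (dist_ball_center G r v).

Definition isomorphism (T1 T2 : finType) (G1 : sgraph T1) (G2 : sgraph T2)
    (f : T1 -> T2) : Prop :=
  bijective f /\ forall x y, adj G2 (f x) (f y) = adj G1 x y.

Definition isomorphic (T1 T2 : finType) (G1 : sgraph T1) (G2 : sgraph T2) : Prop :=
  exists f : T1 -> T2, isomorphism G1 G2 f.

Definition same_neighborhoods (T : finType) (r : nat) (H1 H2 : sgraph T) : Prop :=
  forall v : T,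
  exists2 f : {x : T | x \in dist_ball H1 r v} -> {x : T | x \in dist_ball H2 r v},
    isomorphism (neighborhood H1 r v) (neighborhood H2 r v) f &
    f (nbhd_center H1 r v) = nbhd_center H2 r v.

Definition reconstructable (T : finType) (r : nat) (G : sgraph T) : Prop :=
  forall H : sgraph T, same_neighborhoods r G H -> isomorphic H G.

Definition gnp_mass (R : realType) (n : nat) (p : R) (G : sgraph 'I_n) : R :=
  \prod_(e : {set 'I_n} | #|e| == 2%N) (if e \in edges G then p else 1 - p).

Definition gnp_prob (R : realType) (n : nat) (p : R)
    (E : sgraph 'I_n -> Prop) : R :=
  \sum_(G : sgraph 'I_n | `[< E G >]) gnp_mass p G.

(* Main.v *)
Require Import Defs.
From HB Require Import structures.
From mathcomp Require Import all_boot all_order all_algebra.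
From mathcomp Require Import perm.
From mathcomp Require Import all_classical all_reals all_analysis.
From mathcomp Require Import ring lra.
Import Order.TTheory GRing.Theory Num.Theory numFieldNormedType.Exports.

(** A graph G fails to be determined by its 1-neighborhoods as soon as two
    of its edges [ab], [cd] can be switched to [ad], [cb] without any triangle
    being destroyed or created.  If none of the pairs [ab], [cd], [ad], [cb]
    has a common neighbor, the four edges involved are seen by nobody but
    their own endpoints, and there only as an isolated vertex of the link of
    the center; so the switched graph H has the same 1-neighborhoods
    ([switch_neighborhoods]).  If moreover deg a <> deg c and
    deg b <> deg d, then H has strictly fewer edges than G between
    vertices of degree deg a and vertices of degree deg b, so H and G are
    not isomorphic ([switch_not_isomorphic]).

    It remains to find such a switch in G(n,p), p = n^{-alpha}.  Fix two
    vertices a and c.  The number of pairs (b,d) with [ab] and [cd]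
    edges is the product of two degrees, each within O(sqrt(np)) of
    its mean mu = (n-2)p on average ([deviation_degree_in]), so it is
    about mu^2.  If G is reconstructable, every one of these pairs meets an
    obstruction: b = d, an extra edge among a,b,c,d, a common neighbor, or a
    tie between two degrees.  But given [ab] and [cd], the expected number of
    obstructions is O(p + np^2 + 1/sqrt(np)) ([mean_obstructions]), which tends
    to 0 because alpha > 1/2 makes np^2 vanish and alpha < 1 makes np diverge.
    Comparing both estimates bounds the probability that G is
    reconstructable ([mean_reconstructable_le]).

    The only delicate term is the probability of a degree tie
    ([degree_tie]).  Instead of estimating binomial coefficients, the proof
    uses an exact identity of Stein type.  For f the indicator of
    deg u <= deg v, adding a missing edge [ux] changes f precisely when the
    two degrees are equal; summing the resulting identities over x
    expresses the probability of a tie, up to a small term, by the covariance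
    of deg u and f, which is at most the standard deviation of deg u.

    Apart from the total mass, all expectations rest on a single fact, the
    resampling identity [resample_edge]: in G(n,p) a graph containing the edge e is p/(1-p)
    times as likely as the same graph without e. *)

Set Implicit Arguments.
Unset Strict Implicit.
Unset Printing Implicit Defensive.

Local Open Scope ring_scope.

(** * Switching two edges *)

Section Switching.
Variable T : finType.
Implicit Types (G H : sgraph T) (a b c d u v w x y : T).

Lemma adjC G x y : adj G x y = adj G y x.
Proof. by rewrite /adj finset.setUC. Qed.

Lemma adjxx G x : adj G x x = false.
Proof.
apply/negP => h; have := forall_inP (edges_card2 G) _ h.
by rewrite finset.setUid cards1.
Qed.

Definition degree G v : nat := #|[set u | adj G v u]|.

Lemma set2_eqE x y u v :
  ([set x; y] == [set u; v]) = (x == u) && (y == v) || (x == v) && (y == u).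
Proof.
apply/eqP/orP => [e | [] /andP[/eqP-> /eqP->] //]; last by rewrite finset.setUC.
have := finset.set21 x y; rewrite e !inE.
case/orP => /eqP xE; subst x; [left | right].
- have := finset.set22 u v; have := finset.set22 u y.
  rewrite -{1}e {1}e !inE eqxx /=.
  case: (eqVneq y u) => [->|_] /=; last by move=> ->.
  by rewrite orbb => _ /eqP->; rewrite eqxx.
- have := finset.set21 u v; have := finset.set22 v y.
  rewrite -{1}e {1}e !inE eqxx /=.
  case: (eqVneq y v) => [->|_] /=; last by rewrite orbF => ->.
  by rewrite orbb => _ /eqP->; rewrite eqxx.
Qed.

Lemma mem_dist_ball1 G v u : (u \in dist_ball G 1 v) = (u == v) || adj G v u.
Proof.
rewrite inE; apply/existsP/orP.
- case=> -[[|[|k]] // hk] /existsP[p /andP[]] /=.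
    by rewrite (tuple0 p) /= => _ /eqP->; left.
  by case/tupleP: p => y p; rewrite (tuple0 p) /= andbT => h /eqP<-; right.
- case=> [/eqP-> | h].
    by exists ord0; apply/existsP; exists [tuple]; rewrite /= eqxx.
  exists ord_max; apply/existsP; exists [tuple u] => /=.
  by rewrite h eqxx.
Qed.

Lemma adj_neighborhood G r v (x y : {x : T | x \in dist_ball G r v}) :
  adj (neighborhood G r v) x y = adj G (val x) (val y).
Proof. by rewrite /adj inE finset.imsetU !imset_set1. Qed.

(** Isomorphisms of neighborhoods that come from permutations of the whole
    vertex set; this form keeps the dependent types of the balls out of the
    combinatorics. *)
Lemma same_neighborhoods1 G H (s : T -> {perm T}) :
  (forall v, s v v = v) ->
  (forall v u, adj H v (s v u) = adj G v u) ->
  (forall v u w, adj G v u -> adj G v w -> adj H (s v u) (s v w) = adj G u w) ->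
  same_neighborhoods 1 G H.
Proof.
move=> sv sN sL v.
have ball_s u : (s v u \in dist_ball H 1 v) = (u \in dist_ball G 1 v).
  by rewrite !mem_dist_ball1 sN -{2}(sv v) (inj_eq perm_inj).
have to_H (x : {x : T | x \in dist_ball G 1 v}) :
    s v (val x) \in dist_ball H 1 v.
  by rewrite ball_s (valP x).
have to_G (x : {x : T | x \in dist_ball H 1 v}) :
    (s v)^-1%g (val x) \in dist_ball G 1 v.
  by rewrite -ball_s permKV (valP x).
pose f (x : {x : T | x \in dist_ball G 1 v}) :
    {x : T | x \in dist_ball H 1 v} :=
  exist _ (s v (val x)) (to_H x).
pose g (x : {x : T | x \in dist_ball H 1 v}) :
    {x : T | x \in dist_ball G 1 v} :=
  exist _ ((s v)^-1%g (val x)) (to_G x).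
exists f; last exact/val_inj/sv.
split; first by exists g => x; apply: val_inj; rewrite /= ?permK ?permKV.
move=> x y; rewrite !adj_neighborhood /=.
have := valP x; have := valP y; rewrite !mem_dist_ball1.
move=> /orP[/eqP-> | hy] /orP[/eqP-> | hx]; rewrite ?sv ?adjxx ?sN //.
- by rewrite adjC sN adjC.
- exact: sL.
Qed.

Lemma degree_perm G H (s : {perm T}) v :
  (forall u, adj H v (s u) = adj G v u) -> degree H v = degree G v.
Proof.
move=> sN; rewrite /degree -(card_preimset _ (@perm_inj _ s)).
by apply: eq_card => u; rewrite !inE sN.
Qed.

Lemma switch_card2 G a b c d : a != d -> c != b ->
  [forall e in [set a; d] |:
      ([set c; b] |: (edges G :\ [set a; b] :\ [set c; d])), #|e| == 2%N].
Proof.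
move=> ad cb; apply/forall_inP => e; rewrite !inE.
case/or3P => [/eqP->|/eqP->|/and3P[_ _]]; rewrite ?cards2 ?ad ?cb //.
exact: (forall_inP (edges_card2 G)).
Qed.

Definition no_common_neighbor G u v :=
  [forall x, ~~ (adj G u x && adj G v x)].

(** The edges [ab], [cd] of [G] are replaced by [ad], [cb].  Stating this on
    adjacencies makes the symmetries of a switch provable by rewriting. *)
Definition is_switch G H a b c d := forall x y,
  adj H x y = [|| [set x; y] == [set a; d], [set x; y] == [set c; b] |
    [&& [set x; y] != [set c; d], [set x; y] != [set a; b] & adj G x y]].

Definition switchable G a b c d :=
  [&& adj G a b, adj G c d, ~~ adj G a d & ~~ adj G c b] &&
  [&& no_common_neighbor G a b, no_common_neighbor G c d,
      no_common_neighbor G a d & no_common_neighbor G c b].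

Lemma no_common_neighborP G u v x :
  no_common_neighbor G u v -> adj G u x -> adj G v x = false.
Proof. by move=> /forallP/(_ x); case: (adj G u x) => //= /negbTE. Qed.

Lemma no_common_neighborC G u v :
  no_common_neighbor G u v = no_common_neighbor G v u.
Proof. by apply: eq_forallb => x; rewrite andbC. Qed.

(** The four endpoints of a switch play the same role: the two symmetries
    below act transitively on them, so the effect of a switch is only
    computed at the endpoint [a]. *)
Lemma switchable_flip G a b c d : switchable G a b c d = switchable G b a d c.
Proof.
rewrite /switchable (no_common_neighborC G b a) (no_common_neighborC G d c).
rewrite (no_common_neighborC G b c) (no_common_neighborC G d a).
rewrite (adjC G b a) (adjC G d c) (adjC G b c) (adjC G d a).
by apply/andP/andP => -[/and4P[? ? ? ?] /and4P[? ? ? ?]];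
  split; apply/and4P; split.
Qed.

Lemma switchable_swap G a b c d : switchable G a b c d = switchable G c d a b.
Proof.
rewrite /switchable.
by apply/andP/andP => -[/and4P[? ? ? ?] /and4P[? ? ? ?]];
  split; apply/and4P; split.
Qed.

Lemma is_switch_flip G H a b c d :
  is_switch G H a b c d -> is_switch G H b a d c.
Proof.
move=> sw x y; rewrite sw ![[set b; _]]finset.setUC ![[set d; _]]finset.setUC.
by rewrite orbCA.
Qed.

Lemma is_switch_swap G H a b c d :
  is_switch G H a b c d -> is_switch G H c d a b.
Proof. by move=> sw x y; rewrite sw orbCA [X in _ || (_ || X)]andbCA. Qed.

Lemma switchable_neq G a b c d : switchable G a b c d ->
  [/\ a != b, c != d & a != d] /\ [/\ c != b, a != c & b != d].
Proof.
case/andP => /and4P[ab cd nad ncb] /and4P[Nab Ncd Nad Ncb].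
do 2!split.
- by apply: contraTneq ab => ->; rewrite adjxx.
- by apply: contraTneq cd => ->; rewrite adjxx.
- by apply/eqP => e; have := no_common_neighborP Nad ab; rewrite -e ab.
- by apply/eqP => e; have := no_common_neighborP Ncb cd; rewrite -e cd.
- by apply: contraNneq ncb => <-.
- by apply: contraNneq nad => <-.
Qed.

Lemma switch_neighbors G H a b c d u :
  switchable G a b c d -> is_switch G H a b c d ->
  adj H a (tperm b d u) = adj G a u.
Proof.
move=> swG swH; have [[ab cd ad] [cb ac bd]] := switchable_neq swG.
case/andP: swG => /and4P[Aab Acd nad ncb] _.
rewrite swH !set2_eqE !eqxx (negbTE ac) (negbTE ab) (negbTE ad) /=.
case: tpermP => [->|->|/eqP ub /eqP ud]; rewrite ?eqxx ?Aab //.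
- by rewrite (negbTE bd) (negbTE nad).
- by rewrite (negbTE ud) (negbTE ub).
Qed.

(** In the link of [a], the vertex [b] is isolated before the switch because
    [a] and [b] have no common neighbor, and [d] is isolated after it because
    [a] and [d] have none. *)
Lemma switch_link G H a b c d u w :
  switchable G a b c d -> is_switch G H a b c d ->
  adj G a u -> adj G a w ->
  adj H (tperm b d u) (tperm b d w) = adj G u w.
Proof.
move=> swG swH; have [[ab cd ad] [cb ac bd]] := switchable_neq swG.
case/andP: swG => /and4P[Aab Acd nad ncb] /and4P[Nab Ncd Nad Ncb].
have isolated w' : adj G a w' -> w' != b -> adj H d w' = adj G b w'.
  move=> aw wb; rewrite (no_common_neighborP Nab aw).
  rewrite swH !set2_eqE !eqxx (no_common_neighborP Nad aw) !andbF orbF.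
  rewrite ![d == _]eq_sym (negbTE ad) (negbTE cd) (negbTE bd) /= ?andbF ?orbF.
  by apply/negbTE; apply: contraTneq aw => ->; rewrite adjxx.
have move_ne x : adj G a x -> x != b -> tperm b d x = x.
  move=> ax xb; rewrite tpermD // eq_sym //.
  by apply: contraNneq nad => <-.
move=> au aw.
have [->|ub] := eqVneq u b; have [->|wb] := eqVneq w b;
  rewrite ?tpermL ?move_ne //.
- by rewrite !adjxx.
- exact: isolated.
- by rewrite adjC isolated // adjC.
- have [ud wd] : u != d /\ w != d.
    by split; apply: contraNneq nad => <-.
  rewrite swH !set2_eqE (negbTE ub) (negbTE ud) (negbTE wb) (negbTE wd).
  by rewrite ?andbF.
Qed.

Lemma switch_neighborhoods G H a b c d :
  switchable G a b c d -> is_switch G H a b c d ->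
  exists s : T -> {perm T},
    [/\ forall v, s v v = v,
        forall v u, adj H v (s v u) = adj G v u &
        forall v u w, adj G v u -> adj G v w ->
          adj H (s v u) (s v w) = adj G u w].
Proof.
move=> swG swH; have [[ab cd ad] [cb ac bd]] := switchable_neq swG.
(* An endpoint of a switched edge exchanges its old and its new neighbor. *)
pose s v := if (v == a) || (v == c) then tperm b d
            else if (v == b) || (v == d) then tperm a c else 1%g.
have at_endpoint a' b' c' d' :
    switchable G a' b' c' d' -> is_switch G H a' b' c' d' ->
    (forall u, adj H a' (tperm b' d' u) = adj G a' u) /\
    (forall u w, adj G a' u -> adj G a' w ->
       adj H (tperm b' d' u) (tperm b' d' w) = adj G u w).
  by move=> sw1 sw2; split=> [u | u w]; [exact: switch_neighbors sw1 sw2 |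
    exact: switch_link sw1 sw2].
have sP v : (forall u, adj H v (s v u) = adj G v u) /\
    (forall u w, adj G v u -> adj G v w -> adj H (s v u) (s v w) = adj G u w).
  rewrite /s; have [->|va] := eqVneq v a; first exact: at_endpoint swG swH.
  have [->|vc] := eqVneq v c.
    rewrite /= tpermC; apply: at_endpoint; last exact: is_switch_swap.
    by rewrite switchable_swap.
  have [->|vb] := eqVneq v b.
    apply: at_endpoint; last exact: is_switch_flip.
    by rewrite switchable_flip.
  have [->|vd] := eqVneq v d.
    rewrite /= tpermC; apply: at_endpoint;
      last exact/is_switch_flip/is_switch_swap.
    by rewrite -switchable_flip -switchable_swap.
  split=> [u | u w vu vw]; rewrite /= !perm1 swH !set2_eqE.
    by rewrite (negbTE va) (negbTE vb) (negbTE vc) (negbTE vd) ?andbF.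
  case/andP: swG => _ /and4P[Nab Ncd Nad Ncb].
  have not_uw x y : no_common_neighbor G x y ->
      ((u == x) && (w == y) || (u == y) && (w == x)) = false.
    move=> Nxy; have := no_common_neighborP Nxy (x := v).
    rewrite ![adj G _ v]adjC => nv.
    by apply/negP => /orP[] /andP[/eqP ux /eqP wy];
      move: nv; rewrite -ux -wy vu vw => /(_ isT).
  by rewrite !not_uw.
exists s; split=> [v | v | v].
- rewrite /s; case: ifP => [/orP[]/eqP->|_].
  + by rewrite tpermD // eq_sym.
  + by rewrite tpermD // eq_sym.
  + by case: ifP => [/orP[]/eqP->|_]; rewrite ?perm1 ?tpermD.
- exact: (sP v).1.
- exact: (sP v).2.
Qed.

(** The number of ordered edges from a vertex of degree i = deg a to a vertex
    of degree j = deg b is an isomorphism invariant.  The switch removes (a,b)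
    from these edges, and adds none: the new edges (a,d) and (c,b) would need
    deg d = j and deg c = i, and their reverses (d,a) and (b,c) would need
    i = j and then again deg d = j and deg c = i. *)
Lemma switch_not_isomorphic G H a b c d :
  switchable G a b c d -> is_switch G H a b c d ->
  (forall v, degree H v = degree G v) ->
  degree G a != degree G c -> degree G b != degree G d ->
  ~ isomorphic H G.
Proof.
move=> swG swH degH dac dbd [f [fbij fH]].
have [[ab cd ad] [cb ac bd]] := switchable_neq swG.
pose J K := [set z : T * T | adj K z.1 z.2 &&
   ((degree K z.1 == degree G a) && (degree K z.2 == degree G b))].
have degf v : degree G (f v) = degree H v.
  rewrite /degree -(card_preimset _ (bij_inj fbij)).
  by apply: eq_card => u; rewrite !inE fH.
have finj : injective (fun z : T * T => (f z.1, f z.2)).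
  by move=> [x y] [x' y'] [] /(bij_inj fbij)-> /(bij_inj fbij)->.
have cardJ : #|J H| = #|J G|.
  rewrite -[RHS](card_preimset _ finj).
  by apply: eq_card => z; rewrite !inE /= fH !degf.
suff : J H \proper J G by move/proper_card; rewrite cardJ ltnn.
apply/properP; split.
  apply/fintype.subsetP => -[x y]; rewrite !inE /= !degH => /and3P[].
  rewrite swH !set2_eqE => h dx dy; rewrite dx dy !andbT.
  case/or3P: h => [||/and3P[_ _ //]] /orP[] /andP[/eqP xE /eqP yE];
    move: dx dy; rewrite xE yE.
  - by move=> _; rewrite eq_sym (negbTE dbd).
  - by move=> /eqP h1 /eqP h2; rewrite h1 h2 eqxx in dbd.
  - by rewrite eq_sym (negbTE dac).
  - by move=> /eqP h1 /eqP h2; rewrite h2 h1 eqxx in dac.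
exists (a, b); first by rewrite inE /= !eqxx !andbT; case/andP: swG => /and4P[].
rewrite inE /= !degH !eqxx !andbT swH !set2_eqE !eqxx.
by rewrite (negbTE ab) (negbTE ad) (negbTE ac) ?(negbTE bd) /= ?andbF.
Qed.

Lemma switch_not_reconstructable G a b c d :
  switchable G a b c d ->
  degree G a != degree G c -> degree G b != degree G d ->
  ~ reconstructable 1 G.
Proof.
move=> swG dac dbd rG; have [[_ _ ad] [cb _ _]] := switchable_neq swG.
pose H := SGraph (switch_card2 G ad cb).
have swH : is_switch G H a b c d by move=> x y; rewrite /adj !inE.
have [s [sv sN sL]] := switch_neighborhoods swG swH.
have degH v : degree H v = degree G v by apply: (degree_perm (s := s v)).
exact/(switch_not_isomorphic swG swH degH dac dbd)/rG/(same_neighborhoods1 sv).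
Qed.

End Switching.

(** * Expectations over the random graph *)

Section Expectation.
Variables (R : realType) (n : nat) (p : R).
Hypothesis p01 : 0 <= p <= 1.
Implicit Types (G : sgraph 'I_n) (e : {set 'I_n}) (f g h : sgraph 'I_n -> R).

Definition mean f : R := \sum_G gnp_mass p G * f G.
Local Notation "''E' f" := (mean f) (at level 10, f at level 8).

Lemma eq_mean f g : f =1 g -> 'E f = 'E g.
Proof. by move=> fg; apply: eq_bigr => G _; rewrite fg. Qed.

Lemma gnp_mass_ge0 G : 0 <= gnp_mass p G.
Proof.
case/andP: p01 => p0 p1; apply: prodr_ge0 => e _.
by case: ifP; rewrite ?subr_ge0.
Qed.

Lemma le_mean f g : (forall G, f G <= g G) -> 'E f <= 'E g.
Proof.
by move=> fg; apply: ler_sum => G _; rewrite ler_wpM2l ?gnp_mass_ge0.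
Qed.

Lemma meanD f g : 'E (fun G => f G + g G) = 'E f + 'E g.
Proof. by rewrite -big_split; apply: eq_bigr => G _; rewrite mulrDr. Qed.

Lemma meanZ k f : 'E (fun G => k * f G) = k * 'E f.
Proof. by rewrite /mean mulr_sumr; apply: eq_bigr => G _; rewrite mulrCA. Qed.

Lemma meanB f g : 'E (fun G => f G - g G) = 'E f - 'E g.
Proof. by rewrite -sumrB; apply: eq_bigr => G _; rewrite mulrBr. Qed.

Lemma mean_sum (I : finType) (P : pred I) (F : I -> sgraph 'I_n -> R) :
  'E (fun G => \sum_(i | P i) F i G) = \sum_(i | P i) 'E (F i).
Proof. by rewrite exchange_big; apply: eq_bigr => G _; rewrite mulr_sumr. Qed.

Lemma mean_ge0 f : (forall G, 0 <= f G) -> 0 <= 'E f.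
Proof.
by move=> f0; apply: sumr_ge0 => G _; rewrite mulr_ge0 ?gnp_mass_ge0.
Qed.

Lemma mean1 : 'E (fun=> 1) = 1.
Proof.
(* A set of pairs is a graph exactly when it avoids the sets e with |e| <> 2;
   giving those the weights 0 and 1 turns the sum over graphs into the
   expansion of a product of 1s. *)
pose F e : R := if #|e| == 2%N then p else 0.
pose F' e : R := if #|e| == 2%N then 1 - p else 1.
transitivity (\prod_e (F e + F' e)); last first.
  by rewrite big1 // => e _; rewrite /F /F'; case: ifP => _; lra.
rewrite bigA_distr.
rewrite (bigID (fun A : {set {set 'I_n}} => [forall e in A, #|e| == 2%N])) /=.
rewrite [X in _ = _ + X]big1 ?addr0; last first.
  move=> A /forall_inPn[e eA he]; rewrite (bigD1 e) //= eA /F.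
  by rewrite (negbTE he) mul0r.
have G0P : [forall e in (finset.set0 : {set {set 'I_n}}), #|e| == 2%N].
  by apply/forall_inP => e; rewrite inE.
pose G0 := SGraph G0P.
rewrite (reindex_onto (@edges _) (insubd G0)) /=; last first.
  by move=> A hA; rewrite insubdK.
apply: eq_big => [G|G _]; first by rewrite (valP G) valKd eqxx.
rewrite mulr1 /gnp_mass [RHS](bigID (fun e : {set 'I_n} => #|e| == 2%N)) /=.
rewrite [X in _ = _ * X]big1 ?mulr1; last first.
  move=> e he; rewrite /F /F' (negbTE he).
  by case: ifP => // /(forall_inP (edges_card2 G)); rewrite (negbTE he).
by apply: eq_bigr => e he; rewrite /F /F' he.
Qed.

Definition add_edge e G : sgraph 'I_n := insubd G (e |: edges G).
Definition remove_edge e G : sgraph 'I_n := insubd G (edges G :\ e).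

Lemma edges_add_edge e G : #|e| = 2%N -> edges (add_edge e G) = e |: edges G.
Proof.
move=> he; rewrite /add_edge val_insubd ifT //; apply/forall_inP => x.
by rewrite !inE => /orP[/eqP->|/(forall_inP (edges_card2 G)) //]; rewrite he.
Qed.

Lemma edges_remove_edge e G : edges (remove_edge e G) = edges G :\ e.
Proof.
rewrite /remove_edge val_insubd ifT //; apply/forall_inP => x.
by rewrite !inE => /andP[_ /(forall_inP (edges_card2 G))].
Qed.

Definition edge_ind e G : R := (e \in edges G)%:R.

(** Adding [e] is a bijection from the graphs without [e] to the graphs with
    [e], and it multiplies the mass by p / (1 - p). *)
Lemma resample_edge e h : #|e| = 2%N ->
  (1 - p) * 'E (fun G => edge_ind e G * h G) =
  p * 'E (fun G => (1 - edge_ind e G) * h (add_edge e G)).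
Proof.
move=> he; rewrite /mean.
rewrite (bigID (fun G : sgraph 'I_n => e \in edges G)) /=.
rewrite [X in _ * (_ + X)]big1 ?addr0; last first.
  by move=> G /negbTE eG; rewrite /edge_ind eG mul0r mulr0.
rewrite [in RHS](bigID (fun G : sgraph 'I_n => e \in edges G)) /=.
rewrite [X in _ = _ * (X + _)]big1 ?add0r; last first.
  by move=> G eG; rewrite /edge_ind eG subrr mul0r mulr0.
rewrite (reindex_onto (add_edge e) (remove_edge e)); last first.
  move=> G eG; apply: val_inj.
  by rewrite /= edges_add_edge // edges_remove_edge finset.setD1K.
rewrite !mulr_sumr; apply: eq_big => G.
  rewrite edges_add_edge // setU11 /=; apply/eqP/idP => [<-|eG].
    by rewrite edges_remove_edge !inE eqxx.
  by apply: val_inj; rewrite /= edges_remove_edge edges_add_edge // setU1K.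
rewrite edges_add_edge // setU11 /= => /eqP Gk.
have eG : e \notin edges G by rewrite -Gk edges_remove_edge !inE eqxx.
rewrite /edge_ind edges_add_edge // setU11 (negbTE eG) subr0 !mul1r !mulrA.
congr (_ * _); rewrite /gnp_mass.
rewrite (bigD1 e) ?he //= [X in _ = _ * X](bigD1 e) ?he //=.
rewrite edges_add_edge // setU11 (negbTE eG) mulrCA; congr (_ * (_ * _)).
by apply: eq_bigr => x /andP[_ /negbTE xe]; rewrite !inE xe.
Qed.

Definition ignores_edge e f := forall G, f (add_edge e G) = f G.

Lemma mean_edge e h : #|e| = 2%N -> ignores_edge e h ->
  'E (fun G => edge_ind e G * h G) = p * 'E h.
Proof.
move=> he eh; have := resample_edge h he.
have -> : 'E (fun G => (1 - edge_ind e G) * h (add_edge e G)) =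
    'E h - 'E (fun G => edge_ind e G * h G).
  by rewrite -meanB; apply: eq_mean => G; rewrite eh mulrBl mul1r.
by move=> ?; lra.
Qed.

Lemma ignores_edge_ind e e' :
  #|e| = 2%N -> e' != e -> ignores_edge e (edge_ind e').
Proof.
by move=> he e'e G; rewrite /edge_ind edges_add_edge // !inE (negbTE e'e).
Qed.

Definition edges_ind (s : seq {set 'I_n}) G : R := \prod_(e <- s) edge_ind e G.

Lemma ignores_edges_ind e s : #|e| = 2%N -> e \notin s ->
  ignores_edge e (edges_ind s).
Proof.
move=> he es G; rewrite /edges_ind !big_seq; apply: eq_bigr => e' e's.
by apply: ignores_edge_ind => //; apply: contraNneq es => <-.
Qed.

Lemma edges_ind_ge0 s G : 0 <= edges_ind s G.
Proof. by apply: prodr_ge0 => e _; rewrite ler0n. Qed.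

Lemma mean_edges s : uniq s -> all (fun e => #|e| == 2%N) s ->
  'E (edges_ind s) = p ^+ size s.
Proof.
elim: s => [_ _|e s IH /= /andP[es us] /andP[/eqP he hs]].
  by rewrite -[RHS]mean1; apply: eq_mean => G; rewrite /edges_ind big_nil.
rewrite exprS -IH //; transitivity ('E (fun G => edge_ind e G * edges_ind s G)).
  by apply: eq_mean => G; rewrite /edges_ind big_cons.
by apply: mean_edge => //; exact: ignores_edges_ind.
Qed.

Lemma mean_edge_centered e h : #|e| = 2%N -> ignores_edge e h ->
  'E (fun G => (edge_ind e G - p) * h G) = 0.
Proof.
move=> he eh; rewrite -(subrr (p * 'E h)) -{1}(mean_edge he eh).
rewrite -meanZ -meanB; apply: eq_mean => G.
by rewrite mulrBl.
Qed.

Lemma mean_edge_variance e h : #|e| = 2%N -> ignores_edge e h ->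
  'E (fun G => (edge_ind e G - p) ^+ 2 * h G) = p * (1 - p) * 'E h.
Proof.
move=> he eh.
(* (I - p)^2 = (1 - 2p) I + p^2 for an indicator I. *)
have -> : p * (1 - p) * 'E h = (1 - p *+ 2) * (p * 'E h) + p ^+ 2 * 'E h.
  by ring.
rewrite -(mean_edge he eh) -!meanZ -meanD.
apply: eq_mean => G; rewrite /edge_ind.
by case: (e \in _) => /=; ring.
Qed.

(** * Concentration of degrees and degree ties *)

Section Star.
Variables (u : 'I_n) (A : {set 'I_n}) (s : seq {set 'I_n}).
Hypothesis uA : u \notin A.
Hypothesis us : uniq s.
Hypothesis s2 : all (fun e => #|e| == 2%N) s.
Hypothesis sA : forall x, x \in A -> [set u; x] \notin s.

Definition degree_in G : R := \sum_(x in A) edge_ind [set u; x] G.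

Let card_ux x : x \in A -> #|[set u; x]| = 2%N.
Proof.
by move=> xA; rewrite cards2; case: eqVneq xA => // <-; rewrite (negbTE uA).
Qed.

Lemma mean_degree_in :
  'E (fun G => edges_ind s G * degree_in G) = p ^+ size s * (#|A|%:R * p).
Proof.
transitivity
  ('E (fun G => \sum_(x in A) edge_ind [set u; x] G * edges_ind s G)).
  by apply: eq_mean => G; rewrite mulrC mulr_suml.
rewrite mean_sum (eq_bigr (fun=> p * p ^+ size s)) => [|x xA].
  by rewrite sumr_const -mulr_natl; ring.
rewrite mean_edge ?card_ux // ?mean_edges //.
by apply: ignores_edges_ind; rewrite ?card_ux ?sA.
Qed.

(** The terms I_ux - p are centered and independent of each other and of the
    edges in [s], so only the diagonal of the squared sum contributes. *)
Lemma variance_degree_in :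
  'E (fun G => edges_ind s G * (degree_in G - #|A|%:R * p) ^+ 2) =
  p ^+ size s * (#|A|%:R * (p * (1 - p))).
Proof.
pose c x G := edge_ind [set u; x] G - p.
transitivity ('E (fun G => \sum_(x in A) \sum_(y in A)
   c x G * (c y G * edges_ind s G))).
  apply: eq_mean => G.
  have -> : degree_in G - #|A|%:R * p = \sum_(x in A) c x G.
    by rewrite mulr_natl /c sumrB sumr_const.
  rewrite mulrC expr2 -mulrA mulr_suml; apply: eq_bigr => x _.
  by rewrite mulr_suml mulr_sumr.
rewrite mean_sum (eq_bigr (fun=> p * (1 - p) * p ^+ size s)) => [|x xA].
  by rewrite sumr_const -mulr_natl; ring.
have hs y : y \in A -> ignores_edge [set u; y] (edges_ind s).
  by move=> yA; apply: ignores_edges_ind; rewrite ?card_ux ?sA.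
rewrite mean_sum (bigD1 x) //= big1 ?addr0 => [|y /andP[yA yx]].
  rewrite -(mean_edges us s2) -(mean_edge_variance (card_ux xA));
    last exact: hs.
  by apply: eq_mean => G; rewrite mulrA -expr2.
apply: mean_edge_centered; first exact: card_ux.
move=> G; rewrite hs // /c ignores_edge_ind ?card_ux //.
rewrite set2_eqE eqxx /= (negbTE yx) /=.
by apply: contraNN uA => /andP[/eqP->].
Qed.

(** The mean absolute deviation is at most the standard deviation.  The
    factor [edges_ind s] conditions on the edges in [s]. *)
Lemma deviation_degree_in : 0 < #|A|%:R * p ->
  'E (fun G => edges_ind s G * `|degree_in G - #|A|%:R * p|) <=
  p ^+ size s * Num.sqrt (#|A|%:R * p).
Proof.
move=> mp0; set m := #|A|%:R * p; set l := Num.sqrt m.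
have l0 : 0 < l by rewrite sqrtr_gt0.
have l2 : l ^+ 2 = m by rewrite sqr_sqrtr // ltW.
have [p0 p1] := andP p01.
pose D G := degree_in G - m.
(* |D| <= (l + D^2 / l) / 2 with l = sqrt(mp), an upper bound of the standard
   deviation, replaces Cauchy-Schwarz. *)
apply: (@le_trans _ _ ('E (fun G => 2^-1 * (l * edges_ind s G +
    l^-1 * (edges_ind s G * D G ^+ 2))))).
  apply: le_mean => G.
  have -> : 2^-1 * (l * edges_ind s G + l^-1 * (edges_ind s G * D G ^+ 2)) =
    edges_ind s G * (2^-1 * (l + l^-1 * D G ^+ 2)) by ring.
  apply: ler_wpM2l; first exact: edges_ind_ge0.
  rewrite -/(D G) -subr_ge0.
  have -> : 2^-1 * (l + l^-1 * D G ^+ 2) - `|D G| =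
      2^-1 * l^-1 * (l - `|D G|) ^+ 2.
    rewrite -[D G ^+ 2]real_normK ?num_real //; field.
    by rewrite gt_eqF.
  by rewrite mulr_ge0 ?sqr_ge0 // mulr_ge0 ?invr_ge0 ?ler0n // ltW.
rewrite meanZ meanD !meanZ variance_degree_in mean_edges //.
have -> : #|A|%:R * (p * (1 - p)) = l ^+ 2 * (1 - p) by rewrite l2 /m; ring.
have -> : 2^-1 * (l * p ^+ size s +
      l^-1 * (p ^+ size s * (l ^+ 2 * (1 - p)))) =
    p ^+ size s * l * (1 - 2^-1 * p) by field; rewrite gt_eqF.
rewrite -[leRHS]mulr1 ler_wpM2l //; last by lra.
by rewrite mulr_ge0 ?exprn_ge0 // ltW.
Qed.

Lemma degree_add_edge G x : u != x -> ~~ adj G u x ->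
  degree (add_edge [set u; x] G) u = (degree G u).+1.
Proof.
move=> ux nux.
have -> : degree (add_edge [set u; x] G) u = #|x |: [set y | adj G u y]|.
  apply: eq_card => y; rewrite !inE /adj edges_add_edge ?cards2 ?ux //.
  by rewrite in_setU1 set2_eqE eqxx (negbTE ux) /= orbF.
by rewrite cardsU1 inE nux.
Qed.

Lemma degree_add_edge_other G x v : u != x -> v != u -> v != x ->
  degree (add_edge [set u; x] G) v = degree G v.
Proof.
move=> ux vu vx; apply: eq_card => y; rewrite !inE /adj.
rewrite edges_add_edge ?cards2 ?ux // in_setU1 set2_eqE.
by rewrite (negbTE vu) (negbTE vx).
Qed.

(** Adding the missing edge [ux] raises the degree of [u] by one and keeps the
    degree of [v], so it falsifies [degree G u <= degree G v] exactly in case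
    of a tie. *)
Lemma degree_tie_edge x v : x \in A -> v != u -> v \notin A ->
  'E (fun G => (p - edge_ind [set u; x] G) *
        (edges_ind s G * (degree G u <= degree G v)%:R)) =
  p * 'E (fun G => (1 - edge_ind [set u; x] G) *
        (edges_ind s G * (degree G u == degree G v)%:R)).
Proof.
move=> xA vu vA; set e := [set u; x].
have ux : u != x by apply: contraNneq uA => ->.
have vx : v != x by apply: contraNneq vA => ->.
pose f G := edges_ind s G * (degree G u <= degree G v)%:R : R.
transitivity (p * 'E (fun G => (1 - edge_ind e G) * f G) -
              (1 - p) * 'E (fun G => edge_ind e G * f G)).
  rewrite -!meanZ -meanB; apply: eq_mean => G.
  by rewrite /f; ring.
rewrite resample_edge ?card_ux // -mulrBr -meanB; congr (_ * _).
apply: eq_mean => G; rewrite -mulrBr.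
rewrite {1}/edge_ind [in RHS]/edge_ind; case: (boolP (e \in edges G)) => [_|ne].
  by rewrite subrr !mul0r.
rewrite /f ignores_edges_ind ?card_ux ?sA //.
rewrite degree_add_edge // degree_add_edge_other //.
by case: ltngtP => _ /=; ring.
Qed.

(** Write m for [#|A|] and S for [degree_in].  Summing [degree_tie_edge] over
    [A], p E[(m - S) 1(deg u = deg v)] = E[(mp - S) 1(deg u <= deg v)], where
    everything is conditioned on [s].  The right side is at most sqrt(mp), and
    p E[S 1(deg u = deg v)] is at most p^2 m; so a tie has probability at
    most 1/sqrt(mp) + p. *)
Lemma degree_tie v : 0 < #|A|%:R * p -> v != u -> v \notin A ->
  'E (fun G => edges_ind s G * (degree G u == degree G v)%:R) <=
  p ^+ size s * ((Num.sqrt (#|A|%:R * p))^-1 + p).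
Proof.
move=> mp0 vu vA; set m := #|A|%:R * p; set l := Num.sqrt m.
have l0 : 0 < l by rewrite sqrtr_gt0.
have l2 : l ^+ 2 = m by rewrite sqr_sqrtr // ltW.
have [p0 p1] := andP p01.
pose t G : R := (degree G u == degree G v)%:R.
pose r G : R := (degree G u <= degree G v)%:R.
have key : 'E (fun G => (m - degree_in G) * (edges_ind s G * r G)) =
    p * 'E (fun G => (#|A|%:R - degree_in G) * (edges_ind s G * t G)).
  transitivity ('E (fun G => \sum_(x in A) (p - edge_ind [set u; x] G) *
        (edges_ind s G * r G))).
    apply: eq_mean => G; rewrite -mulr_suml sumrB sumr_const.
    by rewrite -[p *+ _]mulr_natl.
  rewrite mean_sum (eq_bigr (fun x => p * 'E (fun G =>
    (1 - edge_ind [set u; x] G) * (edges_ind s G * t G)))); last first.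
    by move=> x xA; apply: degree_tie_edge.
  rewrite -mulr_sumr -mean_sum; congr (_ * _).
  by apply: eq_mean => G; rewrite -mulr_suml sumrB sumr_const.
have lhs : 'E (fun G => (m - degree_in G) * (edges_ind s G * r G)) <=
    p ^+ size s * l.
  apply: le_trans (deviation_degree_in mp0); apply: le_mean => G.
  rewrite mulrCA ler_wpM2l ?edges_ind_ge0 // -/m distrC.
  by rewrite /r; case: leqP => _; rewrite ?mulr1 ?mulr0 // ler_norm.
have rhs : p * 'E (fun G => degree_in G * (edges_ind s G * t G)) <=
    p * (p ^+ size s * m).
  rewrite ler_wpM2l // -mean_degree_in; apply: le_mean => G.
  rewrite mulrCA ler_wpM2l ?edges_ind_ge0 //.
  have d0 : 0 <= degree_in G by apply: sumr_ge0 => x _; rewrite ler0n.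
  by rewrite /t; case: eqP => _; rewrite ?mulr1 ?mulr0.
have E_t : m * 'E (fun G => edges_ind s G * t G) <=
    p ^+ size s * l + p * (p ^+ size s * m).
  apply: le_trans (lerD lhs rhs); rewrite key -mulrDr -meanD /m -mulrA mulrCA.
  rewrite -meanZ ler_wpM2l //; apply: le_mean => G.
  by rewrite -mulrDl subrK.
rewrite -(ler_pM2l mp0) -/m; apply: le_trans E_t _.
rewrite -l2 le_eqVlt; apply/orP; left; apply/eqP; field.
by rewrite gt_eqF.
Qed.

End Star.
End Expectation.

(** * Obstructions to a switch at two given vertices *)

Section Obstructions.
Variables (R : realType) (n : nat) (p : R).
Hypothesis p01 : 0 <= p <= 1.
Variables (a c : 'I_n).
Hypothesis ac : a != c.
Implicit Types (G : sgraph 'I_n) (b d x : 'I_n).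
Local Notation "''E' f" := (mean p f) (at level 10, f at level 8).
Local Notation ind s := (edges_ind R s).

Definition others : {set 'I_n} := ~: [set a; c].

(** Everything that may prevent the switch of [ab] and [cd], as a number, so
    that its expectation is a sum of elementary ones.  The edges [bd] and [ac]
    count because [b] and [c] are candidates for a common neighbor of [a] and
    [d]; with them and [ad], [cb] listed, common neighbors are only looked
    for outside {a, b, c, d}, where all edges involved are distinct. *)
Definition obstructions b d G : nat :=
  (adj G a d + adj G c b + adj G b d + adj G a c +
   \sum_(x in ~: [set a; c; b; d])
      (adj G a x && adj G b x + adj G c x && adj G d x +
       adj G a x && adj G d x + adj G c x && adj G b x) +
   (degree G a == degree G c) + (degree G b == degree G d))%N.

Lemma no_obstruction b d G : adj G a b -> adj G c d ->
  obstructions b d G = 0%N -> ~ reconstructable 1 G.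
Proof.
move=> ab cd /eqP; rewrite /obstructions !addn_eq0 !eqb0.
move=> /andP[/andP[/andP[/andP[/andP[/andP[ad cb] bd] nac] Nx] dac] dbd].
have Nx' x : x != a -> x != b -> x != c -> x != d ->
   [/\ ~~ (adj G a x && adj G b x), ~~ (adj G c x && adj G d x),
       ~~ (adj G a x && adj G d x) & ~~ (adj G c x && adj G b x)].
  move=> xa xb xc xd; move: Nx; rewrite sum_nat_eq0 => /forall_inP/(_ x).
  rewrite !inE !negb_or xa xb xc xd => /(_ isT).
  by rewrite !addn_eq0 !eqb0 => /andP[/andP[/andP[? ?] ?] ?].
apply: (switch_not_reconstructable (b := b) (d := d)) dac dbd.
rewrite /switchable ab cd ad cb /=.
apply/and4P; split; apply/forallP => x; (have [->|xa] := eqVneq x a;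
  [|have [->|xb] := eqVneq x b; [|have [->|xc] := eqVneq x c;
  [|have [->|xd] := eqVneq x d; [|by case: (Nx' x)]]]]).
all: rewrite ?adjxx ?andbF //.
all: rewrite ?[adj G b a]adjC ?[adj G c a]adjC ?[adj G d a]adjC
  ?[adj G b c]adjC ?[adj G d b]adjC ?[adj G d c]adjC.
all: by rewrite ?(negbTE ad) ?(negbTE cb) ?(negbTE bd) ?(negbTE nac) ?andbF.
Qed.

Lemma mean_two_edges b d (s : seq {set 'I_n}) :
  uniq [:: [set a; b], [set c; d] & s] ->
  all (fun e : {set 'I_n} => #|e| == 2%N) [:: [set a; b], [set c; d] & s] ->
  'E (fun G => ind [:: [set a; b]; [set c; d]] G * ind s G) =
  p ^+ 2 * p ^+ size s.
Proof.
move=> us s2; rewrite -exprD -(mean_edges p us s2).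
by apply: eq_mean => G; rewrite /edges_ind !big_cons big_nil mulr1 !mulrA.
Qed.

(** Given [ab] and [cd], each of the four single edges has probability p, each
    of the at most 4n pairs of edges to a common neighbor has probability p^2,
    and each of the two ties is bounded by [degree_tie]. *)
Lemma mean_obstructions b d :
  b \in others -> d \in others -> b != d -> 0 < (n - 4)%:R * p ->
  'E (fun G => ind [:: [set a; b]; [set c; d]] G * (obstructions b d G)%:R) <=
  p ^+ 2 * (4 * p + 4 * n%:R * p ^+ 2 +
            2 * ((Num.sqrt ((n - 4)%:R * p))^-1 + p)).
Proof.
rewrite !inE !negb_or => /andP[ba bc] /andP[da dc] bd mp0.
have [ab [cb [ad cd]]] : a != b /\ c != b /\ a != d /\ c != d.
  by rewrite ![_ == b]eq_sym ![_ == d]eq_sym.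
have db : d != b by rewrite eq_sym.
have ca : c != a by rewrite eq_sym.
set A := ~: [set a; c; b; d].
have cardA : #|A| = (n - 4)%N.
  rewrite cardsCs finset.setCK card_ord; congr (_ - _)%N.
  rewrite (finset.setUC _ [set d]) (finset.setUC _ [set b]).
  rewrite !cardsU1 !inE !cards1.
  by rewrite !negb_or ac ba bc da dc db.
set z := ind [:: [set a; b]; [set c; d]].
have card2_edge x y : x != y -> #|[set x; y]| == 2%N.
  by move=> xy; rewrite cards2 xy.
have neqs := (negbTE ab, negbTE ad, negbTE ac, negbTE cb, negbTE cd, negbTE ca,
   negbTE ba, negbTE da, negbTE bc, negbTE dc, negbTE bd, negbTE db).
have E1 x y : x != y -> [set x; y] != [set a; b] -> [set x; y] != [set c; d] ->
    'E (fun G => z G * ind [:: [set x; y]] G) = p ^+ 2 * p.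
  move=> xy h1 h2; rewrite mean_two_edges //=; last by rewrite !card2_edge.
  by rewrite !inE !negb_or ![_ == [set x; y]]eq_sym h1 h2 set2_eqE !neqs.
have E2 x y v : x \in A -> y \in [set a; c] -> v \in [set b; d] ->
    'E (fun G => z G * ind [:: [set y; x]; [set v; x]] G) = p ^+ 2 * p ^+ 2.
  rewrite !inE !negb_or => /andP[/andP[/andP[xa xc] xb] xd] yac vbd.
  have xx := (negbTE xa, negbTE xb, negbTE xc, negbTE xd).
  have xx' : (((a == x) = false) * ((b == x) = false) *
      ((c == x) = false) * ((d == x) = false))%type.
    by rewrite ![_ == x]eq_sym !xx.
  rewrite mean_two_edges //=.
    rewrite !inE !negb_or !set2_eqE.
    by case/orP: yac => /eqP->; case/orP: vbd => /eqP->;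
      rewrite !(neqs, xx, xx', eqxx).
  rewrite !card2_edge //=.
    by case/orP: vbd => /eqP->; rewrite !xx'.
  by case/orP: yac => /eqP->; rewrite !xx'.
have tie u v : u \notin A -> v \notin A -> v != u ->
    'E (fun G => z G * (degree G u == degree G v)%:R) <=
    p ^+ 2 * ((Num.sqrt ((n - 4)%:R * p))^-1 + p).
  move=> uA vA vu; rewrite -cardA; apply: degree_tie; rewrite ?cardA //=.
  - by rewrite !inE set2_eqE !neqs.
  - by rewrite !cards2 ab cd.
  - move=> x; rewrite !inE !negb_or => /andP[/andP[/andP[xa xc] xb] xd].
    have xx := (negbTE xa, negbTE xb, negbTE xc, negbTE xd).
    by rewrite !set2_eqE ![x == _]eq_sym ![_ == x]eq_sym !xx !andbF.
have obsE G : z G * (obstructions b d G)%:R =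
  z G * ind [:: [set a; d]] G + z G * ind [:: [set c; b]] G +
  z G * ind [:: [set b; d]] G + z G * ind [:: [set a; c]] G +
  \sum_(x in A) (z G * ind [:: [set a; x]; [set b; x]] G +
    z G * ind [:: [set c; x]; [set d; x]] G +
    z G * ind [:: [set a; x]; [set d; x]] G +
    z G * ind [:: [set c; x]; [set b; x]] G) +
  z G * (degree G a == degree G c)%:R + z G * (degree G b == degree G d)%:R.
  rewrite /obstructions !natrD !mulrDr; congr (_ + _ + _); congr (_ + _).
    by rewrite /edges_ind !big_cons !big_nil !mulr1.
  rewrite natr_sum mulr_sumr; apply: eq_bigr => x _.
  rewrite !natrD !mulrDr /edges_ind !big_cons !big_nil !mulr1.
  by rewrite -!mulnb !natrM.
rewrite (eq_mean _ obsE) !meanD mean_sum.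
have sumE : \sum_(x in A) 'E (fun G => z G * ind [:: [set a; x]; [set b; x]] G +
    z G * ind [:: [set c; x]; [set d; x]] G +
    z G * ind [:: [set a; x]; [set d; x]] G +
    z G * ind [:: [set c; x]; [set b; x]] G) <=
    n%:R * (4 * (p ^+ 2 * p ^+ 2)).
  rewrite (eq_bigr (fun=> 4 * (p ^+ 2 * p ^+ 2))) => [|x xA].
    rewrite sumr_const -[_ *+ #|_|]mulr_natl ler_wpM2r //;
      last by rewrite ler_nat cardA leq_subr.
    by case/andP: p01 => p0 _; rewrite !mulr_ge0 ?exprn_ge0 ?ler0n.
  rewrite !meanD !E2 ?finset.set21 ?finset.set22 //; ring.
rewrite !E1 //; last 8 first.
1-8: by rewrite set2_eqE !neqs ?andbF.
have notA x : x \in [set a; c; b; d] -> x \notin A.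
  by rewrite finset.in_setC negbK.
have Ta := tie _ _ (notA a _) (notA c _) ca.
have Tb := tie _ _ (notA b _) (notA d _) db.
move: Ta Tb; rewrite !inE !eqxx !orbT => /(_ isT isT) Ta /(_ isT isT) Tb.
apply: le_trans (lerD (lerD (lerD (lexx _) sumE) Ta) Tb) _.
by rewrite le_eqVlt; apply/orP; left; apply/eqP; ring.
Qed.

Let m : R := (n - 2)%:R.
Let delta : R := 4 * p + 4 * n%:R * p ^+ 2 +
  2 * ((Num.sqrt ((n - 4)%:R * p))^-1 + p).

Lemma card_others : #|others| = (n - 2)%N.
Proof. by rewrite cardsCs finset.setCK card_ord cards2 ac. Qed.

(** Let X and Y count the edges from [a] and from [c] to the other vertices,
    with mean mu = mp, and let r be the indicator of reconstructability.
    Where r = 1, each of the XY pairs of edges meets an obstruction, so that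
    mu^2 r <= T + mu |X - mu| + X |Y - mu| with T the number of obstructions.
    Taking expectations and dividing by mu^2 gives the bound: the pairs with
    b = d contribute 1/m, the others [delta], and the two deviations
    1/sqrt(mu) each. *)
Lemma mean_reconstructable_le : 0 < (n - 4)%:R * p ->
  'E (fun G => (`[< reconstructable 1 G >])%:R) <=
  m^-1 + delta + 2 * (Num.sqrt (m * p))^-1.
Proof.
move=> mp0; have /andP[p0 p1] := p01.
have n4 : (4 < n)%N.
  rewrite ltnNge; apply: contraTN mp0 => n4.
  by rewrite (eqP (n4 : (n - 4 == 0)%N)) mul0r ltxx.
have pgt0 : 0 < p.
  by move: mp0; rewrite pmulr_rgt0 // ltr0n subn_gt0.
have mgt0 : 0 < m by rewrite ltr0n subn_gt0 (leq_trans _ n4).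
set mu := m * p; have mu0 : 0 < mu by rewrite mulr_gt0.
set l := Num.sqrt mu.
have l0 : 0 < l by rewrite sqrtr_gt0.
have l2 : l ^+ 2 = mu by rewrite sqr_sqrtr // ltW.
pose r G : R := (`[< reconstructable 1 G >])%:R.
pose X G : R := degree_in R a others G.
pose Y G : R := degree_in R c others G.
pose T b d G : R := if b == d then ind [:: [set a; b]; [set c; b]] G
  else ind [:: [set a; b]; [set c; d]] G * (obstructions b d G)%:R.
have aO : a \notin others by rewrite !inE eqxx.
have cO : c \notin others by rewrite !inE eqxx orbT.
have r01 G : 0 <= r G <= 1 by rewrite /r; case: `[< _ >]; rewrite ?lexx ?ler01.
have X0 G : 0 <= X G by apply: sumr_ge0 => b _; rewrite ler0n.
have T_ge b d G :
    edge_ind R [set a; b] G * edge_ind R [set c; d] G * r G <= T b d G.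
  have -> : edge_ind R [set a; b] G * edge_ind R [set c; d] G =
      ind [:: [set a; b]; [set c; d]] G.
    by rewrite /edges_ind !big_cons big_nil mulr1.
  rewrite /T; case: eqVneq => [->|bd].
    by rewrite ler_piMr ?edges_ind_ge0 //; case/andP: (r01 G).
  have [z0|zn0] := eqVneq (ind [:: [set a; b]; [set c; d]] G) 0.
    by rewrite z0 !mul0r.
  rewrite ler_wpM2l ?edges_ind_ge0 //.
  have [ab cd] : adj G a b /\ adj G c d.
    move: zn0; rewrite /edges_ind !big_cons big_nil mulr1 /edge_ind -natrM.
    by rewrite pnatr_eq0 mulnb eqb0 negbK => /andP.
  case: (posnP (obstructions b d G)) => [N0|N0].
    rewrite /r; case: asboolP => // rG.
    by case: (no_obstruction ab cd N0).
  by apply: (@le_trans _ _ 1); [case/andP: (r01 G) | rewrite ler1n].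
have pointwise G : mu ^+ 2 * r G <=
    \sum_(b in others) \sum_(d in others) T b d G +
    mu * `|X G - mu| + X G * `|Y G - mu|.
  have XY : X G * Y G * r G <= \sum_(b in others) \sum_(d in others) T b d G.
    rewrite /X /Y /degree_in mulr_suml mulr_suml; apply: ler_sum => b _.
    by rewrite mulr_sumr mulr_suml; apply: ler_sum => d _; exact: T_ge.
  have -> : mu ^+ 2 * r G =
      X G * Y G * r G + (mu * (mu - X G) + X G * (mu - Y G)) * r G by ring.
  rewrite -addrA lerD //; have /andP[r0 r1] := r01 G.
  apply: (@le_trans _ _ ((mu * `|X G - mu| + X G * `|Y G - mu|) * r G)).
    by rewrite ler_wpM2r // lerD // ler_wpM2l ?(ltW mu0) // distrC ler_norm.
  by rewrite ler_piMr // addr_ge0 // mulr_ge0 // ltW.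
have meanX : 'E (fun G => `|X G - mu|) <= l.
  have := @deviation_degree_in R n p p01 a others [::] aO isT isT.
  rewrite card_others expr0 mul1r => /(_ (fun _ _ => isT) mu0).
  apply: le_trans; apply: le_mean => // G.
  by rewrite /edges_ind big_nil mul1r.
have meanXY : 'E (fun G => X G * `|Y G - mu|) <= mu * l.
  have -> : 'E (fun G => X G * `|Y G - mu|) =
     \sum_(b in others) 'E (fun G => ind [:: [set a; b]] G * `|Y G - mu|).
    rewrite -mean_sum; apply: eq_mean => G; rewrite -mulr_suml; congr (_ * _).
    by apply: eq_bigr => b _; rewrite /edges_ind big_cons big_nil mulr1.
  apply: (@le_trans _ _ (\sum_(b in others) p * l)); last first.
    by rewrite sumr_const card_others -[_ *+ _]mulr_natl mulrA.
  apply: ler_sum => b; rewrite !inE !negb_or => /andP[ba bc].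
  have := @deviation_degree_in R n p p01 c others [:: [set a; b]] cO isT.
  rewrite card_others expr1 => dev; apply: dev => //.
    by rewrite /= cards2 [a == b]eq_sym ba.
  move=> x; rewrite !inE !negb_or => /andP[xa xc].
  by rewrite set2_eqE eq_sym (negbTE ac) /= [c == b]eq_sym (negbTE bc).
have meanT : 'E (fun G => \sum_(b in others) \sum_(d in others) T b d G) <=
    m * p ^+ 2 + m ^+ 2 * (p ^+ 2 * delta).
  have d0 : 0 <= delta.
    by rewrite /delta !addr_ge0 ?mulr_ge0 ?addr_ge0 ?invr_ge0 ?sqrtr_ge0
      ?exprn_ge0 ?ler0n.
  rewrite mean_sum.
  apply: (@le_trans _ _
    (\sum_(b in others) (p ^+ 2 + m * (p ^+ 2 * delta)))).
    apply: ler_sum => b bO; rewrite mean_sum (bigD1 b) //=; apply: lerD.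
      rewrite /T eqxx mean_edges //=.
        move: bO; rewrite !inE negb_or => /andP[/negbTE ba _].
        by rewrite set2_eqE (negbTE ac) [a == b]eq_sym ba.
      move: bO; rewrite !inE negb_or => /andP[ba bc].
      by rewrite !cards2 [a == b]eq_sym [c == b]eq_sym ba bc.
    apply: (@le_trans _ _ (\sum_(d in others | d != b) (p ^+ 2 * delta))).
      apply: ler_sum => d /andP[dO db]; rewrite /T eq_sym (negbTE db).
      by apply: mean_obstructions => //; rewrite eq_sym.
    apply: (@le_trans _ _ (\sum_(d in others) (p ^+ 2 * delta))).
      by rewrite [leRHS](bigD1 b) //= lerDr mulr_ge0 ?exprn_ge0.
    by rewrite sumr_const card_others -[_ *+ _]mulr_natl.
  by rewrite sumr_const card_others -[_ *+ _]mulr_natl mulrDr -/m expr2 !mulrA.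
have total : mu ^+ 2 * 'E r <=
    m * p ^+ 2 + m ^+ 2 * (p ^+ 2 * delta) + mu * l + mu * l.
  rewrite -meanZ; apply: (le_trans (le_mean p01 pointwise)).
  rewrite !meanD meanZ; apply: lerD meanXY; apply: lerD meanT _.
  by rewrite ler_wpM2l // ltW.
rewrite -(ler_pM2l (exprn_gt0 2 mu0)); apply: le_trans total _.
rewrite le_eqVlt; apply/orP; left; apply/eqP.
have -> : mu ^+ 2 * (m^-1 + delta + 2 * l^-1) =
  mu ^+ 2 * m^-1 + mu ^+ 2 * delta + mu * l ^+ 2 * 2 * l^-1.
  by rewrite l2; ring.
have muE : mu = m * p by [].
clearbody l; rewrite muE; field.
by rewrite !gt_eqF.
Qed.

End Obstructions.

(** * The limit *)

Lemma gnp_prob_not_reconstructable (R : realType) n (p : R) :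
  gnp_prob p (fun G : sgraph 'I_n => ~ reconstructable 1 G) =
  1 - mean p (fun G : sgraph 'I_n => (`[< reconstructable 1 G >])%:R).
Proof.
rewrite -[X in X - _](mean1 n p) -meanB /gnp_prob big_mkcond /=.
apply: eq_bigr => G _.
by rewrite asbool_neg; case: asboolP => _ /=; ring.
Qed.

Lemma cvg_natr_powRN (R : realType) (beta : R) : 0 < beta ->
  ((fun n : nat => n%:R `^ (- beta)) @ \oo --> (0 : R))%classic.
Proof.
move=> b0; apply/cvgrPdist_lt => e e0; near=> n.
rewrite sub0r normrN ger0_norm ?powR_ge0 // powRN.
have en : e^-1 < n%:R `^ beta.
  have -> : e^-1 = (e^-1 `^ beta^-1) `^ beta.
    by rewrite -powRrM mulVf ?gt_eqF // powRr1 // invr_ge0 ltW.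
  rewrite gt0_ltr_powR // ?nnegrE ?powR_ge0 ?ler0n //.
  by near: n; apply: nbhs_infty_gtr.
have n0 : 0 < n%:R `^ beta by apply: lt_trans en; rewrite invr_gt0.
by rewrite -[e]invrK ltf_pV2 ?posrE ?invr_gt0.
Unshelve. all: by end_near. Qed.

(** The bound of [mean_reconstructable_le] at p = n^-alpha, with n - 2 and
    n - 4 replaced by n / 2: the terms stand for 1/n, p, np^2 and
    1/sqrt(np). *)
Definition failure_bound (R : realType) (alpha : R) (n : nat) : R :=
  2 * n%:R `^ (- 1) + 6 * n%:R `^ (- alpha) +
  4 * n%:R `^ (- (2 * alpha - 1)) +
  4 * Num.sqrt 2 * n%:R `^ (- ((1 - alpha) / 2)).

Lemma failure_probability_le (R : realType) (alpha : R) (n : nat) :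
  0 < alpha -> (8 <= n)%N ->
  1 - failure_bound alpha n <= gnp_prob (n%:R `^ (- alpha))
       (fun G : sgraph 'I_n => ~ reconstructable 1 G) <= 1.
Proof.
move=> a0 n8; rewrite gnp_prob_not_reconstructable.
case: n n8 => [//|[//|n]] n8.
set N := n.+2 in n8 *; set p := _ `^ (- alpha).
have N0 : 0 < N%:R :> R by rewrite ltr0n.
have p0 : 0 < p by apply: powR_gt0.
have p1 : p <= 1.
  rewrite /p powRN invf_le1 ?powR_gt0 //.
  have : 1 `^ alpha <= N%:R `^ alpha :> R.
    by rewrite ge0_ler_powR ?nnegrE ?ler0n ?ler1n // ltW.
  by rewrite powR1.
have p01 : 0 <= p <= 1 by rewrite ltW.
have powD x y : N%:R `^ (x + y) = N%:R `^ x * N%:R `^ y :> R.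
  by apply: powRD; apply/implyP => _; rewrite gt_eqF.
have NpE : N%:R * p = N%:R `^ (1 - alpha).
  by rewrite powD powRr1 ?ltW.
have N4 : N%:R / 2 <= (N - 4)%:R :> R.
  rewrite natrB ?(leq_trans _ n8) //.
  have : 8%:R <= N%:R :> R by rewrite ler_nat.
  lra.
have N2 : N%:R / 2 <= (N - 2)%:R :> R.
  by apply: le_trans N4 _; rewrite ler_nat leq_sub2l.
have N4p : 0 < (N - 4)%:R * p.
  by rewrite mulr_gt0 // (lt_le_trans _ N4) ?divr_gt0.
have := @mean_reconstructable_le R N p p01 ord0 (lift ord0 ord0) isT N4p.
set P := mean p _ => Pub.
have P0 : 0 <= P by apply: mean_ge0 => // G; rewrite ler0n.
have sq k : N%:R / 2 <= k ->
    (Num.sqrt (k * p))^-1 <= Num.sqrt 2 * N%:R `^ (- ((1 - alpha) / 2)).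
  move=> hk; have -> : Num.sqrt 2 * N%:R `^ (- ((1 - alpha) / 2)) =
      (Num.sqrt (N%:R / 2 * p))^-1.
    have -> : N%:R / 2 * p = 2^-1 * N%:R `^ (1 - alpha) by rewrite -NpE; ring.
    rewrite sqrtrM ?invr_ge0 ?ler0n // sqrtrV ?ler0n //.
    rewrite invfM invrK powRN powRrM.
    by rewrite powR12_sqrt // powR_ge0.
  have h0 : 0 < N%:R / 2 * p by rewrite mulr_gt0 // divr_gt0.
  have hkp : N%:R / 2 * p <= k * p by rewrite ler_wpM2r // ltW.
  rewrite lef_pV2 ?posrE ?sqrtr_gt0 ?(lt_le_trans h0) //.
  by rewrite ler_wsqrtr.
apply/andP; split; last by lra.
rewrite lerD2l lerN2; apply: le_trans Pub _.
have i2 : (N - 2)%:R^-1 <= 2 * N%:R `^ (-1) :> R.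
  have -> : 2 * N%:R `^ (-1) = (N%:R / 2)^-1 :> R.
    by rewrite powRN powRr1 ?ltW // invfM invrK mulrC.
  by rewrite lef_pV2 ?posrE ?divr_gt0 ?(lt_le_trans _ N2) ?divr_gt0.
have np2 : N%:R * p ^+ 2 = N%:R `^ (- (2 * alpha - 1)).
  rewrite expr2 mulrA NpE /p -powD.
  by congr (_ `^ _); ring.
have s4 := sq _ N4; have s2 := sq _ N2.
rewrite /failure_bound -np2 -/p.
move: i2 s4 s2.
(* Naming the nonlinear terms leaves a linear inequality. *)
set A := (_%:R)^-1; set B := Num.sqrt 2 * _.
set C := (Num.sqrt _)^-1; set D := (Num.sqrt _)^-1.
have -> : 4 * Num.sqrt 2 * N%:R `^ (- ((1 - alpha) / 2)) = 4 * B.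
  by rewrite mulrA.
move=> i2 s4 s2.
have -> : 4 * N%:R * p ^+ 2 = 4 * (N%:R * p ^+ 2) by rewrite mulrA.
lra.
Qed.

Local Open Scope classical_set_scope.
Local Open Scope ring_scope.

Theorem theorem3 (R : realType) (alpha : R) (halpha : 1 / 2 < alpha < 1) :
  (fun n : nat =>
     gnp_prob (n%:R `^ (- alpha))
       (fun G : sgraph 'I_n => ~ reconstructable 1 G)) @ \oo --> (1 : R).
Proof.
have /andP[a12 a1] := halpha.
have fail0 : failure_bound alpha @ \oo --> (0 : R).
  have -> : 0 = 2 * 0 + 6 * 0 + 4 * 0 + 4 * Num.sqrt 2 * 0 :> R by ring.
  apply: cvgD; [apply: cvgD; [apply: cvgD|]|];
    apply: cvgMr; apply: cvg_natr_powRN; lra.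
apply: (@squeeze_cvgr _ _ _ _ (fun n => 1 - failure_bound alpha n) (fun=> 1)).
- near=> n; apply: failure_probability_le; first by lra.
  by near: n; exact: nbhs_infty_ge.
- by rewrite -[X in _ --> X]subr0; apply: cvgB => //; exact: cvg_cst.
- exact: cvg_cst.
Unshelve. all: by end_near. Qed.
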